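(* Consider an AC/DC network that consists of exactly one AC subgrid and exactly one DC subgrid. Then the linear AC/DC grid model of the network is a leader-follower system; that is, the directions of the converters can be chosen so that the model, with the AC and DC subgrids as its two subsystems, is a leader-follower system.
   Context: **Network.** $\mathcal{N}^{\mathrm{A}}$ and $\mathcal{N}^{\mathrm{D}}$ are disjoint finite sets of AC and DC buses. $\mathcal{E}^{\mathrm{A}}$ (AC lines) is a set of undirected edges between AC buses and $\mathcal{E}^{\mathrm{D}}$ (DC lines) is a set of undirected edges between DC buses. Converters are links each joining an AC bus to a DC bus (at most one per pair of buses); each converter may be given either direction. A choice of directions gives a set $\mathcal{C}$ of directed edges, with $ij\in\mathcal{C}$ implying $ji\notin\mathcal{C}$. The AC subgrids are the connected components of $(\mathcal{N}^{\mathrm{A}},\mathcal{E}^{\mathrm{A}})$ and the DC subgrids are the connected components of $(\mathcal{N}^{\mathrm{D}},\mathcal{E}^{\mathrm{D}})$. $\mathcal{P}$ is the set of all AC and DC subgrids. **Linear AC/DC grid model.** Each converter $e\in\mathcal{C}$ has one scalar control input $\zeta_e$. The states are the angle $\theta_i$ and frequency $\omega_i$ for each $i\in\mathcal{N}^{\mathrm{A}}$, the voltage $v_i$ for each $i\in\mathcal{N}^{\mathrm{D}}$, and one current for each DC line, written $i_{ij}$ with the convention $i_{ji}=-i_{ij}$. For $i\in\mathcal{N}^{\mathrm{A}}$, $$\dot\theta_i=\omega_i,\qquad J_i\dot\omega_i=P_i-D_i\omega_i-\sum_{j:\,ij\in\mathcal{E}^{\mathrm{A}}}B_{ij}(\theta_i-\theta_j)-\sum_{j:\,ij\in\mathcal{C}}\hat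 v_j\zeta_{ij}+\sum_{j:\,ji\in\mathcal{C}}\hat v_j\zeta_{ji}.$$ For $i\in\mathcal{N}^{\mathrm{D}}$, $$C_i\dot v_i=-\sum_{j:\,ij\in\mathcal{E}^{\mathrm{D}}}i_{ij}-\sum_{j:\,ij\in\mathcal{C}}\zeta_{ij}+\sum_{j:\,ji\in\mathcal{C}}\zeta_{ji}.$$ For each DC line $ij\in\mathcal{E}^{\mathrm{D}}$, $$L_{ij}\dot i_{ij}=v_i-v_j-R_{ij}i_{ij}.$$ Here $J_i,C_i,L_{ij}>0$ and $D_i,B_{ij},R_{ij},\hat v_j$ are real constants, with $B_{ij}=B_{ji}$, $L_{ij}=L_{ji}$, $R_{ij}=R_{ji}$. The $P_i$ (generation or load) are exogenous, not control inputs. The model thus has the form $\dot x=Ax+Bu+Fw$ with $x$ the vector of all states, $u=(\zeta_e)_{e\in\mathcal{C}}$, and $w$ exogenous. **Subsystems.** The subsystems are the elements of $\mathcal{P}$. The states of an AC subgrid are $\theta_i,\omega_i$ for its buses $i$; the states of a DC subgrid are $v_i$ for its buses $i$ and the currents of its lines. The input $\zeta_{ij}$ of converter $ij\in\mathcal{C}$ is assigned to the subgrid containing the tail bus $i$. This partitions $x$ and $u$ into blocks indexed by $\mathcal{P}$ (some input blocks may be empty). **Poset-causality and leader-follower systems.** Let $P_{22}(s)=(sI-A)^{-1}B$, with rows partitioned by subsystem states and columns by subsystem inputs; $(P_{22})_{lk}$ is the block with rows in subsystem $l$ and columns in subsystem $k$. For a partial order $\preceq$ on $\mathcal{P}$,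 the system is poset-causal with respect to $\preceq$ if $(P_{22})_{lk}=0$ (as a matrix of rational functions of $s$) whenever $k\not\preceq l$. Write $\downarrow a=\{b\in\mathcal{P}: a\preceq b\}$. The system is a coordinated system if it is poset-causal with respect to a partial order for which there is a coordinator $c\in\mathcal{P}$ with $\downarrow c=\mathcal{P}$, and $\downarrow i=\{i\}$ for every $i\in\mathcal{P}\setminus\{c\}$. A leader-follower system is a coordinated system with a single subsystem besides the coordinator, i.e. $\mathcal{P}=\{c,f\}$ with $c\preceq f$ and $f\not\preceq c$ ($c$ is the leader, $f$ the follower). *)

(* Defs.v *)
From HB Require Import structures.
From mathcomp Require Import all_boot all_order all_algebra reals ring.
Set Implicit Arguments.
Unset Strict Implicit.
Unset Printing Implicit Defensive.
Import GRing.Theory.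
Local Open Scope ring_scope.

(* The AC and DC buses are two separate types, which makes them disjoint;
   [conv i j] says that there is a converter between the AC bus [i] and the
   DC bus [j], without a direction. *)
Record network := Network {
  acbus : finType;
  dcbus : finType;
  acline : rel acbus;
  dcline : rel dcbus;
  conv : acbus -> dcbus -> bool;
  acline_sym : symmetric acline;
  acline_irr : irreflexive acline;
  dcline_sym : symmetric dcline;
  dcline_irr : irreflexive dcline }.

Arguments acline {n} : rename.
Arguments dcline {n} : rename.
Arguments conv {n} : rename.

Definition bus (N : network) : finType := (acbus N + dcbus N)%type.

Definition linked (N : network) (i j : bus N) : bool :=
  match i, j with
  | inl a, inr d | inr d, inl a => conv a d
  | _, _ => false
  end.

Definition conv_directions (N : network) (C : {set bus N * bus N}) : Prop :=
  (forall i j, linked i j = ((i, j) \in C) || ((j, i) \in C)) /\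
  (forall i j, (i, j) \in C -> (j, i) \notin C).

Definition ac_subgrids (N : network) : {set {set acbus N}} :=
  equivalence_partition (connect acline) [set: acbus N].

Definition dc_subgrids (N : network) : {set {set dcbus N}} :=
  equivalence_partition (connect dcline) [set: dcbus N].

Definition subgrid (N : network) : finType :=
  ({X : {set acbus N} | X \in ac_subgrids N} +
   {X : {set dcbus N} | X \in dc_subgrids N})%type.

(* Each undirected DC line {i, j} carries one current state. It is listed here
   once, as the pair (i, j) in which i comes first in the enumeration of the
   buses; this fixes the reference direction of its current. *)
Definition dcedge (N : network) : finType :=
  {p : dcbus N * dcbus N |
    dcline p.1 p.2 && (enum_rank p.1 < enum_rank p.2)%N}.

Inductive state (N : network) :=
  | Theta of acbus N
  | Omega of acbus N
  | Volt of dcbus N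
  | Curr of dcedge N.

Definition state_to_sum (N : network) (s : state N) :
    (acbus N + acbus N) + (dcbus N + dcedge N) :=
  match s with
  | Theta i => inl (inl i)
  | Omega i => inl (inr i)
  | Volt i => inr (inl i)
  | Curr e => inr (inr e)
  end.

Definition state_of_sum (N : network)
    (s : (acbus N + acbus N) + (dcbus N + dcedge N)) : state N :=
  match s with
  | inl (inl i) => Theta i
  | inl (inr i) => Omega i
  | inr (inl i) => Volt i
  | inr (inr e) => Curr e
  end.

Lemma state_to_sumK (N : network) :
  cancel (@state_to_sum N) (@state_of_sum N).
Proof. by case. Qed.

HB.instance Definition _ (N : network) :=
  Finite.copy (state N) (can_type (@state_to_sumK N)).

Definition input (N : network) (C : {set bus N * bus N}) : finType :=
  {e : bus N * bus N | e \in C}.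

(* The values of [lineB], [lineL], [lineR] on pairs of buses that are not
   joined by a line are irrelevant. *)
Record grid_params (R : realType) (N : network) := GridParams {
  inertia : acbus N -> R;                (* J_i *)
  damping : acbus N -> R;                (* D_i *)
  lineB : acbus N -> acbus N -> R;       (* B_ij *)
  vhat : dcbus N -> R;
  capac : dcbus N -> R;                  (* C_i *)
  lineL : dcbus N -> dcbus N -> R;       (* L_ij *)
  lineR : dcbus N -> dcbus N -> R;       (* R_ij *)
  inertia_gt0 : forall i, 0 < inertia i;
  capac_gt0 : forall i, 0 < capac i;
  lineL_gt0 : forall i j, dcline i j -> 0 < lineL i j;
  lineB_sym : forall i j, acline i j -> lineB i j = lineB j i;
  lineL_sym : forall i j, dcline i j -> lineL i j = lineL j i;
  lineR_sym : forall i j, dcline i j -> lineR i j = lineR j i }.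

(* i_ij, with i_ji = - i_ij *)
Definition current (R : realType) (N : network) (x : {ffun state N -> R})
    (i j : dcbus N) : R :=
  if insub (i, j) is Some e then x (Curr e)
  else if insub (j, i) is Some e then - x (Curr e) else 0.

(* zeta_ij, for (i, j) in C *)
Definition zeta (R : realType) (N : network) (C : {set bus N * bus N})
    (u : {ffun input C -> R}) (i j : bus N) : R :=
  oapp u 0 (insub (i, j)).

(* The time derivative of the state [s] when the states, the control inputs
   and the exogenous P_i have the values [x], [u] and [w]. *)
Definition grid_rhs (R : realType) (N : network) (G : grid_params R N)
    (C : {set bus N * bus N}) (x : {ffun state N -> R})
    (u : {ffun input C -> R}) (w : {ffun acbus N -> R}) (s : state N) : R :=
  match s with
  | Theta i => x (Omega i)
  | Omega i =>
      (inertia G i)^-1 *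
      (w i - damping G i * x (Omega i)
       - \sum_(j | acline i j) lineB G i j * (x (Theta i) - x (Theta j))
       - \sum_(j : dcbus N | (inl i, inr j) \in C)
           vhat G j * zeta u (inl i) (inr j)
       + \sum_(j : dcbus N | (inr j, inl i) \in C)
           vhat G j * zeta u (inr j) (inl i))
  | Volt i =>
      (capac G i)^-1 *
      (- \sum_(j | dcline i j) current x i j
       - \sum_(j : acbus N | (inr i, inl j) \in C) zeta u (inr i) (inl j)
       + \sum_(j : acbus N | (inl j, inr i) \in C) zeta u (inl j) (inr i))
  | Curr e =>
      let: (i, j) := val e in
      (lineL G i j)^-1 *
      (x (Volt i) - x (Volt j) - lineR G i j * current x i j)
  end.

Definition unit_ffun (R : realType) (T : finType) (t : T) : {ffun T -> R} :=
  [ffun t' => (t' == t)%:R].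

(* The coefficient matrices of the model x' = A x + B u + F w; see
   [grid_rhsE] below. *)
Definition grid_A (R : realType) (N : network) (G : grid_params R N)
    (C : {set bus N * bus N}) : 'M[R]_(#|{: state N}|) :=
  \matrix_(a, b)
    grid_rhs G (unit_ffun R (enum_val b)) (0 : {ffun input C -> R}) 0
      (enum_val a).

Definition grid_B (R : realType) (N : network) (G : grid_params R N)
    (C : {set bus N * bus N}) : 'M[R]_(#|{: state N}|, #|{: input C}|) :=
  \matrix_(a, b) grid_rhs G 0 (unit_ffun R (enum_val b)) 0 (enum_val a).

Definition grid_F (R : realType) (N : network) (G : grid_params R N)
    (C : {set bus N * bus N}) : 'M[R]_(#|{: state N}|, #|{: acbus N}|) :=
  \matrix_(a, b)
    grid_rhs G 0 (0 : {ffun input C -> R}) (unit_ffun R (enum_val b))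
      (enum_val a).

Lemma grid_rhs_linear (R : realType) (N : network) (G : grid_params R N)
    (C : {set bus N * bus N}) (a : R) (x y : {ffun state N -> R})
    (u v : {ffun input C -> R}) (w z : {ffun acbus N -> R}) (s : state N) :
  grid_rhs G [ffun t => a * x t + y t] [ffun t => a * u t + v t]
    [ffun t => a * w t + z t] s =
  a * grid_rhs G x u w s + grid_rhs G y v z s.
Proof.
have zE i j : zeta [ffun t => a * u t + v t] i j = a * zeta u i j + zeta v i j.
  by rewrite /zeta; case: insub => [e|] /=; rewrite ?ffunE // mulr0 addr0.
have cE i j :
    current [ffun t => a * x t + y t] i j = a * current x i j + current y i j.
  rewrite /current; case: insub => [e|]; first by rewrite !ffunE.
  case: insub => [e|]; last by rewrite mulr0 addr0.
  by rewrite !ffunE opprD mulrN.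
have sE (T : finType) (P : pred T) (f g h : T -> R) :
    (forall t, f t = a * g t + h t) ->
    \sum_(t | P t) f t = a * \sum_(t | P t) g t + \sum_(t | P t) h t.
  move=> fE; rewrite big_distrr -big_split /=.
  by apply: eq_bigr => t _; rewrite fE.
case: s => [i|i|i|e] /=; first by rewrite !ffunE.
- have bE j :
      lineB G i j * ([ffun t => a * x t + y t] (Theta i) -
                     [ffun t => a * x t + y t] (Theta j)) =
      a * (lineB G i j * (x (Theta i) - x (Theta j))) +
      lineB G i j * (y (Theta i) - y (Theta j)).
    by rewrite !ffunE; ring.
  have vE i' j' j : vhat G j * zeta [ffun t => a * u t + v t] i' j' =
      a * (vhat G j * zeta u i' j') + vhat G j * zeta v i' j'.
    by rewrite zE; ring.
  rewrite (sE _ _ _ _ _ bE).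
  rewrite (sE _ _ _ _ _ (fun j => vE (inl i) (inr j) j)).
  rewrite (sE _ _ _ _ _ (fun j => vE (inr j) (inl i) j)).
  by rewrite !ffunE; ring.
- rewrite (sE _ _ _ _ _ (cE i)).
  rewrite (sE _ _ _ _ _ (fun j => zE (inr i) (inl j))).
  by rewrite (sE _ _ _ _ _ (fun j => zE (inl j) (inr i))); ring.
- by case: (val e) => i j; rewrite cE !ffunE; ring.
Qed.

Lemma linear_expand (R : realType) (T : finType) (g : {ffun T -> R} -> R) :
  (forall (a : R) (x y : {ffun T -> R}),
     g [ffun t => a * x t + y t] = a * g x + g y) ->
  forall x, g x = \sum_t g (unit_ffun R t) * x t.
Proof.
move=> gE x; have g0 : g 0 = 0.
  have := gE (-1) 0 0; rewrite mulN1r addNr => <-; congr g.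
  by apply/ffunP => t; rewrite !ffunE mulr0 addr0.
have gs (r : seq T) : g [ffun t => \sum_(t' <- r) (t == t')%:R * x t'] =
    \sum_(t <- r) g (unit_ffun R t) * x t.
  elim: r => [|t r IHr].
    by rewrite big_nil -[RHS]g0; congr g; apply/ffunP => t; rewrite !ffunE big_nil.
  rewrite big_cons mulrC -IHr -gE; congr g; apply/ffunP => t'.
  by rewrite !ffunE big_cons mulrC.
rewrite -gs; congr g; apply/ffunP => t; rewrite ffunE.
rewrite (bigD1 t) //= eqxx mul1r big1 ?addr0 // => t' /negPf.
by rewrite eq_sym => ->; rewrite mul0r.
Qed.

Lemma grid_rhsE (R : realType) (N : network) (G : grid_params R N)
    (C : {set bus N * bus N}) (x : {ffun state N -> R})
    (u : {ffun input C -> R}) (w : {ffun acbus N -> R}) :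
  \col_a grid_rhs G x u w (enum_val a) =
  grid_A G C *m (\col_a x (enum_val a)) +
  grid_B G C *m (\col_a u (enum_val a)) +
  grid_F G C *m (\col_a w (enum_val a)).
Proof.
apply/colP => a; rewrite !mxE; set s := enum_val a.
have c0 (T : finType) (k : R) :
    [ffun t => k * (0 : {ffun T -> R}) t + (0 : {ffun T -> R}) t] = 0.
  by apply/ffunP => t; rewrite !ffunE mulr0 addr0.
have c1 (T : finType) (y : {ffun T -> R}) :
    [ffun t => 1 * y t + (0 : {ffun T -> R}) t] = y.
  by apply/ffunP => t; rewrite !ffunE mul1r addr0.
have c2 (T : finType) (y : {ffun T -> R}) :
    [ffun t => 1 * (0 : {ffun T -> R}) t + y t] = y.
  by apply/ffunP => t; rewrite !ffunE mul1r add0r.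
have -> : grid_rhs G x u w s = grid_rhs G x (0 : {ffun input C -> R}) 0 s +
    grid_rhs G 0 u 0 s + grid_rhs G 0 (0 : {ffun input C -> R}) w s.
  have := grid_rhs_linear G 1 x 0 0 u 0 w s; rewrite c1 !c2 mul1r => ->.
  have := grid_rhs_linear G 1 0 0 u 0 0 w s.
  by rewrite c1 c2 c0 mul1r -addrA => ->.
have red (T : finType) (g : {ffun T -> R} -> R) (y : {ffun T -> R}) :
    (forall (k : R) (p q : {ffun T -> R}),
       g [ffun t => k * p t + q t] = k * g p + g q) ->
    g y = \sum_(b < #|T|) g (unit_ffun R (enum_val b)) * y (enum_val b).
  move=> /linear_expand ->.
  by rewrite (reindex _ (onW_bij _ (@enum_val_bij T))).
congr (_ + _ + _).
- rewrite (red _ (fun y => grid_rhs G y (0 : {ffun input C -> R}) 0 s)).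
    by apply: eq_bigr => b _; rewrite !mxE.
  by move=> k p q; rewrite -grid_rhs_linear !c0.
- rewrite (red _ (fun y => grid_rhs G 0 y 0 s)).
    by apply: eq_bigr => b _; rewrite !mxE.
  by move=> k p q; rewrite -grid_rhs_linear !c0.
- rewrite (red _ (fun y => grid_rhs G 0 (0 : {ffun input C -> R}) y s)).
    by apply: eq_bigr => b _; rewrite !mxE.
  by move=> k p q; rewrite -grid_rhs_linear !c0.
Qed.

(* P22(s) = (s I - A)^-1 B over the field R(s) of rational functions;
   [char_poly_mx A] is s I - A, which is invertible over R(s) by [sIA_unit]. *)
Definition P22 (R : realType) (N : network) (G : grid_params R N)
    (C : {set bus N * bus N}) :
    'M[{fraction {poly R}}]_(#|{: state N}|, #|{: input C}|) :=
  invmx (map_mx (@tofrac _) (char_poly_mx (grid_A G C))) *m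
  map_mx (fun b => tofrac b%:P) (grid_B G C).

Lemma sIA_unit (R : realType) (n : nat) (A : 'M[R]_n) :
  map_mx (@tofrac _) (char_poly_mx A) \in unitmx.
Proof.
by rewrite unitmxE det_map_mx unitfE tofrac_eq0 monic_neq0 ?char_poly_monic.
Qed.

Definition states_of (N : network) (l : subgrid N) : {set state N} :=
  [set s : state N |
    match l, s with
    | inl X, (Theta i | Omega i) => i \in val X
    | inr X, Volt i => i \in val X
    | inr X, Curr e => (val e).1 \in val X
    | _, _ => false
    end].

Definition in_subgrid (N : network) (k : subgrid N) (i : bus N) : bool :=
  match k, i with
  | inl X, inl a => a \in val X
  | inr X, inr d => d \in val X
  | _, _ => false
  end.

Definition inputs_of (N : network) (C : {set bus N * bus N}) (k : subgrid N) :
    {set input C} :=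
  [set e : input C | in_subgrid k (val e).1].

Definition P22_block (R : realType) (N : network) (G : grid_params R N)
    (C : {set bus N * bus N}) (l k : subgrid N) :
    'M[{fraction {poly R}}]_(#|states_of l|, #|inputs_of C k|) :=
  mxsub (fun a => enum_rank (enum_val a)) (fun b => enum_rank (enum_val b))
    (P22 G C).

Definition partial_order (T : finType) (le : rel T) : Prop :=
  [/\ reflexive le, antisymmetric le & transitive le].

Definition poset_causal (R : realType) (N : network) (G : grid_params R N)
    (C : {set bus N * bus N}) (le : rel (subgrid N)) : Prop :=
  forall l k, ~~ le k l -> P22_block G C l k = 0.

Definition downset (T : finType) (le : rel T) (a : T) : {set T} :=
  [set b | le a b].

Definition coordinator (T : finType) (le : rel T) (c : T) : Prop :=
  downset le c = [set: T] /\ forall i, i != c -> downset le i = [set i].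

Lemma coordinator_le (T : finType) (le : rel T) (c f : T) :
  coordinator le c -> f != c -> le c f /\ ~~ le f c.
Proof.
case=> /setP/(_ f); rewrite !inE => lecf fdown fc; split=> //.
by move/setP: (fdown f fc) => /(_ c); rewrite !inE eq_sym (negPf fc) => ->.
Qed.

Definition leader_follower (R : realType) (N : network) (G : grid_params R N)
    (C : {set bus N * bus N}) : Prop :=
  exists (le : rel (subgrid N)) (c f : subgrid N),
    [/\ partial_order le, poset_causal G C le, coordinator le c
      & [set~ c] = [set f]].

(* Main.v *)
Require Import Defs.
From mathcomp Require Import all_boot all_order all_algebra reals.

(** Direct every converter from its AC bus to its DC bus. Every control input
    then belongs to the AC subgrid, so the DC subgrid [f] has no input and the
    block of [P22] from [f] to the AC subgrid [c] has no column, hence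
    vanishes. This block is the only one that must vanish for the order in
    which [c] precedes [f] ([P22_block_no_input]), so [c] is the leader. The entries of the transfer matrix are never computed: the choice
    of the tails alone decides the matter, and the reverse choice would make
    the DC subgrid the leader. *)

Definition ac_to_dc (N : network) : {set bus N * bus N} :=
  [set p | if p is (inl a, inr d) then conv a d else false].

Lemma ac_to_dc_directions (N : network) : conv_directions (ac_to_dc N).
Proof.
by split=> [] [a|d] [a'|d'] //=; rewrite !inE /= ?orbF.
Qed.

Lemma inputs_of_ac_to_dc (N : network)
    (Y : {Y : {set dcbus N} | Y \in dc_subgrids N}) :
  inputs_of (ac_to_dc N) (inr Y) = set0.
Proof.
apply/setP=> -[[[a|d] j] e_dir]; rewrite [RHS]inE [LHS]inE //=.
by move: e_dir; rewrite inE.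
Qed.

Lemma P22_block_no_input (R : realType) (N : network) (G : grid_params R N)
    (C : {set bus N * bus N}) (l k : subgrid N) :
  inputs_of C k = set0 -> P22_block G C l k = 0%R.
Proof.
by move=> Ck0; apply/matrixP=> a b; have /setP/(_ (enum_val b)) := Ck0;
  rewrite enum_valP inE.
Qed.

(** The only relation on [T] that has [c] as a coordinator. *)
Definition star_le (T : finType) (c : T) : rel T :=
  fun k l => (k == c) || (k == l).

Lemma star_le_partial_order (T : finType) (c : T) : partial_order (star_le T c).
Proof.
split=> [x | x y | y x z]; rewrite /star_le; first by rewrite eqxx orbT.
  by case/andP=> /orP[/eqP-> | /eqP-> //] /orP[] /eqP->.
by case/orP=> [-> // | /eqP->].
Qed.

Lemma star_le_coordinator (T : finType) (c : T) : coordinator (star_le T c) c.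
Proof.
split=> [|i /negPf ic]; apply/setP=> j; rewrite !inE /star_le ?eqxx //.
by rewrite ic eq_sym.
Qed.

Lemma card1_sig_unique (T : finType) (A : {set T}) :
  #|A| = 1 -> exists X : {X : T | X \in A}, forall Z, Z = X.
Proof.
move/eqP/cards1P=> [X ->]; exists (exist _ X (set11 X)) => -[Z ZX].
by apply: val_inj; apply/set1P.
Qed.

Theorem corollary2 (R : realType) (N : network) (G : grid_params R N)
    (one_ac : #|ac_subgrids N| = 1) (one_dc : #|dc_subgrids N| = 1) :
  exists C : {set bus N * bus N},
    conv_directions C /\ leader_follower G C.
Proof.
have [X Xuniq] := card1_sig_unique _ _ one_ac.
have [Y Yuniq] := card1_sig_unique _ _ one_dc.
exists (ac_to_dc N); split; first exact: ac_to_dc_directions.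
pose c : subgrid N := inl X.
exists (star_le _ c), c, (inr Y); split.
- exact: star_le_partial_order.
- move=> l [Z | Z]; first by rewrite (Xuniq Z) /star_le eqxx.
  by move=> _; apply: P22_block_no_input; apply: inputs_of_ac_to_dc.
- exact: star_le_coordinator.
- apply/setP=> -[Z | Z]; rewrite !inE; first by rewrite (Xuniq Z) eqxx.
  by rewrite (Yuniq Z) eqxx.
Qed.
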